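(* (Per-head discrete first-order condition.) Let $\lambda_1\ge\cdots\ge\lambda_d\ge0$, $q(b)=\tfrac1{12}2^{-2b}$, and $$D(r,b)=\sum_{i>r}\lambda_i+q(b)\sum_{i\le r}\lambda_i .$$ Consider the integer problem $$\min_{\substack{r\in\{r_{\min},\,r_{\min}+2,\,\ldots,\,d\}\\ b\in\{b_{\min},\ldots,b_{\max}\}}} D(r,b)\quad\text{s.t.}\quad r\cdot b\le B .$$ Substituting $b=B/r$ reduces this to the one-dimensional discrete objective $f(r):=D(r,B/r)$, whose forward difference is $$\Delta f(r):=f(r+2)-f(r)=-\bigl(\lambda_{r+1}+\lambda_{r+2}\bigr)\Bigl(1-q\bigl(\tfrac{B}{r+2}\bigr)\Bigr)+\Bigl(q\bigl(\tfrac{B}{r+2}\bigr)-q\bigl(\tfrac{B}{r}\bigr)\Bigr)\sum_{i\le r}\lambda_i .$$ Any integer optimum $r^\star$ on this grid satisfies the two-sided first-order condition $$\Delta f(r^\star-2)\;\le\;0\;\le\;\Delta f(r^\star),$$ with the convention $\Delta f(r_{\min}-2):=-\infty$ and $\Delta f(d):=+\infty$ at the boundary.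
   Context: The $\lambda_i$ are the eigenvalues of the covariance of a zero-mean $d$-dimensional key (or value) vector of one attention head. $D(r,b)$ is the head-level mean squared reconstruction error when the top $r$ eigendirections are kept and each retained (Hadamard-rotated) coordinate is quantized by a uniform $b$-bit scalar quantizer. $B$ is the head's total bit budget; $r_{\min}$, $b_{\min}$, $b_{\max}$ are given integer bounds on rank and bit width. *)

(* Defs.v *)
From HB Require Import structures.
From mathcomp Require Import all_boot all_order all_algebra.
From mathcomp Require Import all_classical all_reals all_analysis.

Set Implicit Arguments.
Unset Strict Implicit.
Unset Printing Implicit Defensive.
Import Order.TTheory GRing.Theory Num.Theory.
Local Open Scope ring_scope.

Section RankBitAllocation.
Variable R : realType.

Definition q (b : R) : R := 12^-1 * 2 `^ (- (2 * b)).

(* Eigenvalues are numbered from 1: only lam 1, ..., lam d are ever used. *)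
Definition D (d : nat) (lam : nat -> R) (r : nat) (b : R) : R :=
  \sum_(r.+1 <= i < d.+1) lam i + q b * \sum_(1 <= i < r.+1) lam i.

Definition in_grid (rmin d r : nat) : bool :=
  [&& (rmin <= r)%N, (r <= d)%N & (2 %| r - rmin)%N].

Definition feasible (rmin d bmin bmax : nat) (B : R) (r b : nat) : Prop :=
  [/\ in_grid rmin d r, (bmin <= b <= bmax)%N & r%:R * b%:R <= B].

Definition integer_optimum (rmin d bmin bmax : nat) (B : R)
    (lam : nat -> R) (r b : nat) : Prop :=
  feasible rmin d bmin bmax B r b /\
  forall s c : nat, feasible rmin d bmin bmax B s c ->
    D d lam r b%:R <= D d lam s c%:R.

(* The value assigned to B / 0 is irrelevant: for r = 0 the factor
   multiplying q in D is an empty sum. *)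
Definition f (d : nat) (lam : nat -> R) (B : R) (r : nat) : R :=
  D d lam r (B / r%:R).

Definition grid_optimum (rmin d : nat) (lam : nat -> R) (B : R)
    (r : nat) : Prop :=
  in_grid rmin d r /\
  forall s : nat, in_grid rmin d s -> f d lam B r <= f d lam B s.

Definition Deltaf (d : nat) (lam : nat -> R) (B : R) (r : nat) : R :=
  f d lam B r.+2 - f d lam B r.

(* Deltaf extended by the boundary conventions. The argument is an int because
   rmin - 2 may be negative; away from the two boundary points it is only
   meaningful at nonnegative r, where `|r| is r as a natural number. *)
Definition Deltaf_ext (rmin d : nat) (lam : nat -> R) (B : R) (r : int) :
    \bar R :=
  if r == rmin%:Z - 2 then -oo%E
  else if r == d%:Z then +oo%E
  else (Deltaf d lam B `|r|%N)%:E.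

End RankBitAllocation.

(* Main.v *)
Require Import Defs.
From HB Require Import structures.
From mathcomp Require Import all_boot all_order all_algebra.
From mathcomp Require Import all_classical all_reals all_analysis.
From mathcomp Require Import zify ring.
Import Order.TTheory GRing.Theory Num.Theory.
Local Open Scope ring_scope.

(** More bits never hurt: [q] is nonincreasing and the retained eigenvalues have nonnegative sum, so
    at fixed rank the width B/r, which spends the whole budget, is best ([f_le_D]). If these widths
    are all admissible integers, each f(r) is attained by a feasible pair, and the integer problem
    and [f] have the same optimal ranks ([integer_optimumP]). The difference formula is bookkeeping:
    two eigenvalues move from the discarded sum to the quantized one ([DeltafE]). The first-order
    condition needs no convexity: a minimizer is compared with its neighbours r - 2 and r + 2, and
    infinite values stand in for a missing neighbour. *)

Lemma q_nonincreasing (R : realType) (b c : R) : b <= c -> q c <= q b.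
Proof.
move=> le_bc; rewrite /q ler_wpM2l ?invr_ge0 ?ler0n// ler_powR ?ler1n//.
by rewrite lerN2 ler_wpM2l ?ler0n.
Qed.

Lemma D0 (R : realType) (d : nat) (lam : nat -> R) (b c : R) :
  D d lam 0 b = D d lam 0 c.
Proof. by rewrite /D !(@big_geq _ _ _ 1 1)// !mulr0. Qed.

Lemma f_le_D (R : realType) (d : nat) (lam : nat -> R) (B : R)
    (r : nat) (b : R) :
  (forall i : nat, (1 <= i)%N -> (i <= d)%N -> 0 <= lam i) ->
  (r <= d)%N -> r%:R * b <= B -> f d lam B r <= D d lam r b.
Proof.
move=> lam_ge0 le_rd le_rbB; rewrite /f.
(* At rank 0 the budget does not bound b, but nothing is quantized, so the width is immaterial. *)
case: (posnP r) => [->|r_gt0]; first by rewrite (D0 _ _ _ _ b).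
rewrite /D lerD2l ler_wpM2r//.
  rewrite big_nat_cond sumr_ge0// => i /andP[/andP[i_gt0 le_ir] _].
  by rewrite lam_ge0// (leq_trans _ le_rd).
by rewrite q_nonincreasing// ler_pdivlMr ?ltr0n// mulrC.
Qed.

Lemma f_eq_D (R : realType) (d : nat) (lam : nat -> R) (B : R)
    (r : nat) (b : R) :
  r%:R * b = B -> f d lam B r = D d lam r b.
Proof.
move=> <-; rewrite /f; case: (posnP r) => [->|r_gt0]; first exact: D0.
by rewrite mulrC mulrA mulVf ?mul1r// pnatr_eq0 -lt0n.
Qed.

Lemma integer_optimumP (R : realType) (d : nat) (lam : nat -> R)
    (rmin bmin bmax : nat) (B : R) (r : nat) :
  (forall i : nat, (1 <= i)%N -> (i <= d)%N -> 0 <= lam i) ->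
  (forall s : nat, in_grid rmin d s ->
     exists b : nat, (bmin <= b <= bmax)%N /\ s%:R * b%:R = B) ->
  (exists b : nat, integer_optimum rmin d bmin bmax B lam r b) <->
  grid_optimum rmin d lam B r.
Proof.
move=> lam_ge0 exact_width; split.
  move=> [b [[grid_r _ le_rbB] opt]]; split=> // s grid_s.
  have [c [c_bounds scB]] := exact_width s grid_s.
  (* The chain is f(r) <= D(r,b) <= D(s,c) = f(s), with c the exact width at s. *)
  rewrite (f_eq_D _ _ _ _ s c%:R)//.
  apply: le_trans (opt s c _); last by split=> //; rewrite scB.
  by apply: f_le_D => //; case/and3P: grid_r.
move=> [grid_r opt]; have [b [b_bounds rbB]] := exact_width r grid_r.
(* With b the exact width at r, D(r,b) = f(r) <= f(s) <= D(s,c). *)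
exists b; split=> [|s c [grid_s _ le_scB]]; first by split=> //; rewrite rbB.
rewrite -(f_eq_D _ _ _ _ _ _ rbB) (le_trans (opt s grid_s))// f_le_D//.
by case/and3P: grid_s.
Qed.

Lemma DeltafE (R : realType) (d : nat) (lam : nat -> R) (B : R) (r : nat) :
  (r.+2 <= d)%N ->
  Deltaf d lam B r =
    - (lam r.+1 + lam r.+2) * (1 - q (B / r.+2%:R))
    + (q (B / r.+2%:R) - q (B / r%:R)) * \sum_(1 <= i < r.+1) lam i.
Proof.
move=> le_r2d; rewrite /Deltaf /f /D.
(* Split both eigenvalues off the tail at r and off the head at r + 2; the remaining sums are common
   to both. *)
rewrite (@big_ltn _ _ _ r.+1) ?ltnS; last exact: ltnW.
rewrite (@big_ltn _ _ _ r.+2) ?ltnS//.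
by rewrite (@big_nat_recr _ _ _ r.+2)//= (@big_nat_recr _ _ _ r.+1)//=; ring.
Qed.

(** Parity prevents overshooting: r and d both agree with [rmin] modulo 2, so r < d forces r + 2 <=
    d. *)
Lemma in_grid_succ (rmin d r : nat) :
  in_grid rmin d d -> in_grid rmin d r -> (r < d)%N -> in_grid rmin d r.+2.
Proof. by rewrite /in_grid; lia. Qed.

Lemma in_grid_pred (rmin d r : nat) :
  in_grid rmin d r -> r != rmin ->
  exists2 s : nat, r = s.+2 & in_grid rmin d s.
Proof.
by move=> grid_r ne_r; exists (r - 2)%N; move: grid_r ne_r; rewrite /in_grid; lia.
Qed.

Lemma grid_optimum_first_order (R : realType) (d : nat) (lam : nat -> R)
    (rmin : nat) (B : R) (r : nat) :
  in_grid rmin d d -> grid_optimum rmin d lam B r ->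
  (Deltaf_ext rmin d lam B (r%:Z - 2) <= 0)%E /\
  (0 <= Deltaf_ext rmin d lam B r%:Z)%E.
Proof.
move=> grid_d [grid_r opt]; have /and3P[le_rminr le_rd _] := grid_r.
rewrite /Deltaf_ext; split.
  have [->|ne_r] := eqVneq r rmin; first by rewrite eqxx.
  have [s def_r grid_s] := in_grid_pred _ _ _ grid_r ne_r; subst r.
  (* Here r - 2 = s is a genuine grid point below d, so neither boundary convention applies. *)
  rewrite ifF; last by lia.
  rewrite ifF; last by lia.
  have -> : `|s.+2%:Z - 2|%N = s by lia.
  by rewrite lee_fin /Deltaf subr_le0 opt.
rewrite ifF; last by lia.
case: eqP => // ne_rd; rewrite lee_fin /Deltaf subr_ge0 opt//.
by apply: in_grid_succ => //; lia.
Qed.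

Theorem propositionB1 (R : realType) (d : nat) (lam : nat -> R)
    (rmin bmin bmax : nat) (B : R)
    (lam_nonincreasing : forall i j : nat,
       (1 <= i)%N -> (i <= j)%N -> (j <= d)%N -> lam j <= lam i)
    (lam_ge0 : forall i : nat, (1 <= i)%N -> (i <= d)%N -> 0 <= lam i)
    (d_in_grid : in_grid rmin d d) :
  [/\ (* b = B / r is a best bit width for each rank r *)
      forall (r : nat) (b : R), in_grid rmin d r -> r%:R * b <= B ->
        f d lam B r <= D d lam r b,
      (* when b = B / r is always an admissible bit width,
         the reduction to f is exact *)
      (forall r : nat, in_grid rmin d r ->
         exists b : nat, (bmin <= b <= bmax)%N /\ r%:R * b%:R = B) ->
      forall r : nat,
        (exists b : nat, integer_optimum rmin d bmin bmax B lam r b) <->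
        grid_optimum rmin d lam B r,
      forall r : nat, in_grid rmin d r -> (r < d)%N ->
        Deltaf d lam B r =
          - (lam r.+1 + lam r.+2) * (1 - q (B / r.+2%:R))
          + (q (B / r.+2%:R) - q (B / r%:R)) * \sum_(1 <= i < r.+1) lam i
    & forall rstar : nat, grid_optimum rmin d lam B rstar ->
        (Deltaf_ext rmin d lam B (rstar%:Z - 2) <= 0)%E /\
        (0 <= Deltaf_ext rmin d lam B rstar%:Z)%E].
Proof.
split.
- by move=> r b /and3P[_ le_rd _]; exact: f_le_D.
- by move=> exact_width r; exact: integer_optimumP.
- move=> r grid_r lt_rd; apply: DeltafE.
  by have /and3P[] := in_grid_succ _ _ _ d_in_grid grid_r lt_rd.
- by move=> r; exact: grid_optimum_first_order.
Qed.
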